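(* Let $G$ be a finitely generated group and let $X$ be a countably infinite set. The following conditions are equivalent: (1) $G$ is LERF. (2) The collection $\mathrm{Sub}^{\mathrm{fi}}(G)$ of finite index subgroups of $G$ is dense in $\mathrm{Sub}(G)$. (3) $G$ has a generic permutation representation on $X$, all of whose orbits are finite; that is, there is $\tau^*\in\mathrm{Hom}(G,X!)$ all of whose orbits on $X$ are finite and whose $X!$-orbit is co-meager in $\mathrm{Hom}(G,X!)$.
   Context: A group $G$ is LERF (locally extended residually finite, or subgroup separable) if every finitely generated subgroup of $G$ is an intersection of finite index subgroups of $G$. $\mathrm{Sub}(G)$ is the set of all subgroups of $G$ with the Chabauty topology, i.e. the topology induced from the product topology on $\{0,1\}^G$. $X!$ is the group of all permutations of $X$ with the topology of pointwise convergence, a Polish group; $\mathrm{Hom}(G,X!)$ carries the topology of pointwise convergence (as a closed subspace of $(X!)^G$), which makes it a Polish space. $X!$ acts on $\mathrm{Hom}(G,X!)$ by $(\alpha\cdot\varphi)(g)=\alpha\varphi(g)\alpha^{-1}$. Co-meager means containing a countable intersection of dense open sets. *)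

(* Defs.v *)
From HB Require Import structures.
From mathcomp Require Import all_boot.
From mathcomp Require Import all_classical all_reals topology.

Set Implicit Arguments.
Unset Strict Implicit.
Unset Printing Implicit Defensive.

Local Open Scope classical_set_scope.
Local Open Scope group_scope.

(* A subtype of [X -> X] for the topology of pointwise convergence,
   [X] being discrete. *)
Definition permutation (X : choiceType) : Type :=
  set_type [set f : {ptws X -> discrete_topology X} | bijective f].

HB.instance Definition _ (X : choiceType) := Topological.on (permutation X).

Definition perm_fun (X : choiceType) (f : permutation X) : X -> X := \val f.

Coercion perm_fun : permutation >-> Funclass.

Section PermutationGroup.
Variable X : choiceType.
Implicit Types f g h : permutation X.

Lemma perm_bij f : bijective f.
Proof. by case: f => f fP; exact: set_mem fP. Qed.

Definition mk_perm (f : X -> X) (bij_f : bijective f) : permutation X :=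
  exist _ f (mem_set bij_f).

Lemma perm_ext f g : f =1 g -> f = g.
Proof. by move=> fg; apply/val_inj/funext. Qed.

Lemma perm_inv_subproof f : {g : X -> X | cancel f g & cancel g f}.
Proof. by apply: cid2; have [g fK gK] := perm_bij f; exists g. Qed.

Definition perm_inv_fun f : X -> X := s2val (perm_inv_subproof f).

Lemma perm_invK f : cancel f (perm_inv_fun f).
Proof. exact: s2valP (perm_inv_subproof f). Qed.

Lemma perm_funK f : cancel (perm_inv_fun f) f.
Proof. exact: s2valP' (perm_inv_subproof f). Qed.

Lemma bij_perm_inv f : bijective (perm_inv_fun f).
Proof. exact: Bijective (perm_funK f) (perm_invK f). Qed.

Definition perm_one : permutation X := mk_perm (@inv_bij X id (fun=> erefl)).
Definition perm_inv f : permutation X := mk_perm (bij_perm_inv f).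
Definition perm_mul f g : permutation X :=
  mk_perm (bij_comp (perm_bij f) (perm_bij g)).

Lemma perm_mulA : associative perm_mul.
Proof. by move=> f g h; apply: perm_ext. Qed.

Lemma perm_mul1 : left_id perm_one perm_mul.
Proof. by move=> f; apply: perm_ext. Qed.

Lemma perm_mulr1 : right_id perm_one perm_mul.
Proof. by move=> f; apply: perm_ext. Qed.

Lemma perm_mulV : left_inverse perm_one perm_inv perm_mul.
Proof. by move=> f; apply: perm_ext => x; exact: perm_invK. Qed.

Lemma perm_mulrV : right_inverse perm_one perm_inv perm_mul.
Proof. by move=> f; apply: perm_ext => x; exact: perm_funK. Qed.

(* The product is composition, [(f * g) x = f (g x)], so that permutations act
   on the left. *)
HB.instance Definition _ := isGroup.Build (permutation X)
  perm_mulA perm_mul1 perm_mulr1 perm_mulV perm_mulrV.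

End PermutationGroup.

Section Subgroups.
Variable G : groupType.

(* The Chabauty topology on [subgroup] is induced by the product topology of
   [{0,1}^G]. *)
Definition subgroup : Type :=
  set_type [set S : {ptws G -> bool} | group_closed (S : {pred G})].

HB.instance Definition _ := Topological.on subgroup.

Definition carrier (H : subgroup) : set G := [set x | (\val H : G -> bool) x].

Definition generated (A : set G) : set G := smallest (range carrier) A.

Definition finitely_generated (A : set G) : Prop :=
  exists2 B : set G, finite_set B & A = generated B.

Definition left_cosets (H : subgroup) : set (set G) :=
  range (fun x : G => [set x * h | h in carrier H]).

Definition subgroup_fi : set subgroup := [set H | finite_set (left_cosets H)].

Definition LERF : Prop :=
  forall H : subgroup, finitely_generated (carrier H) ->
    exists2 F : set subgroup, F `<=` subgroup_fi &
      carrier H = \bigcap_(K in F) carrier K.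

End Subgroups.

Definition comeager (T : topologicalType) (A : set T) : Prop :=
  exists2 U : nat -> set T, forall n, open (U n) /\ dense (U n) &
    \bigcap_n U n `<=` A.

Section Representations.
Variables (G : groupType) (X : choiceType).

Definition permRep : Type :=
  set_type [set phi : {ptws G -> permutation X} | {morph phi : x y / x * y}].

HB.instance Definition _ := Topological.on permRep.

Definition rep_fun (phi : permRep) : G -> permutation X := \val phi.

Coercion rep_fun : permRep >-> Funclass.

Lemma rep_morph (phi : permRep) : {morph phi : x y / x * y}.
Proof. by case: phi => phi phiP; exact: set_mem phiP. Qed.

Definition rep_orbit (phi : permRep) (x : X) : set X :=
  range (fun g => phi g x).

Lemma conj_rep_morph (a : permutation X) (phi : permRep) :
  {morph (fun g => a * phi g * a^-1) : x y / x * y}.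
Proof. by move=> x y; rewrite rep_morph !mulgA mulgVK. Qed.

Definition conj_rep (a : permutation X) (phi : permRep) : permRep :=
  exist _ (fun g => a * phi g * a^-1) (mem_set (conj_rep_morph a phi)).

Definition conj_orbit (phi : permRep) : set permRep :=
  range (fun a => conj_rep a phi).

End Representations.

(* Main.v *)
Require Import Defs.
From mathcomp Require Import all_boot.
From mathcomp Require Import all_classical all_reals topology.

(* LERF says that a finitely generated subgroup [H] can be approximated by finite
   index subgroups on any finite subset of [G]; since [H] and the subgroup
   generated by a finite part of [H] agree on that part, this is the density of
   the finite index subgroups.

   If they are dense, let [tau] be the disjoint union, over the countably many
   finite index subgroups [K], of infinitely many copies of [G / K].  Finite
   patterns of any representation occur in [tau], so its conjugacy orbit is
   dense.  That orbit contains the G_delta set of the representations with finite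
   orbits in which every finite index subgroup is infinitely often a stabilizer:
   two such representations are conjugate by back and forth.

   Conversely, a co-meager orbit is dense (Baire).  Given a finitely generated [H]
   and [g] outside [H], realize [H] as the stabilizer of a point [x]; a conjugate
   of [tau] in which the generators of [H] fix [x] and [g] does not provides a
   finite index stabilizer containing [H] but not [g]. *)

Set Implicit Arguments.
Unset Strict Implicit.
Unset Printing Implicit Defensive.

Local Open Scope classical_set_scope.
Local Open Scope card_scope.
Local Open Scope group_scope.

(** * Subgroups, left cosets and finite index *)

Section Subgroup.
Variable G : groupType.
Implicit Types (H K : subgroup G) (A : set G) (g h : G).

Lemma carrier1 H : carrier H 1.
Proof. by case: H => S SP; have [] := set_mem SP. Qed.

Lemma carrierM H g h : carrier H g -> carrier H h -> carrier H (g * h).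
Proof. by case: H => S SP; move: (set_mem SP) => /group_closedM; apply. Qed.

Lemma carrierV H g : carrier H g -> carrier H g^-1.
Proof. by case: H => S SP; move: (set_mem SP) => /group_closedV; apply. Qed.

Lemma subgroup_ext H K : carrier H = carrier K -> H = K.
Proof.
move=> HK; apply/val_inj/funext => g.
have HKg : carrier H g <-> carrier K g by rewrite HK.
by apply/idP/idP; apply HKg.
Qed.

Lemma subgroup_exists A : A 1 -> (forall g h, A g -> A h -> A (g * h)) ->
  (forall g, A g -> A g^-1) -> exists H, carrier H = A.
Proof.
move=> A1 AM AV; have S : group_closed (fun g => `[< A g >] : bool).
  split; first exact/asboolP.
  by move=> g h /asboolP Ag /asboolP Ah; apply/asboolP/AM/AV.
exists (exist _ (fun g => `[< A g >]) (mem_set S)).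
by apply/seteqP; split=> g /asboolP.
Qed.

(** Induction principle for generated elements, usable with a predicate [B] not packaged as a
    [subgroup]. *)
Lemma generated_min A (B : set G) : B 1 ->
    (forall g h, B g -> B h -> B (g * h)) -> (forall g, B g -> B g^-1) ->
  A `<=` B -> generated A `<=` B.
Proof.
by move=> B1 BM BV; apply: smallest_sub; have [H HB] := subgroup_exists B1 BM BV; exists H.
Qed.

Lemma generated_subgroup A : exists H, carrier H = generated A.
Proof.
apply: subgroup_exists; first by move=> _ [[H _ <-] _]; exact: carrier1.
  by move=> g h Ag Ah B BP; have [[H _ HB] _] := BP; rewrite -HB;
    apply: carrierM; rewrite HB; [exact: Ag | exact: Ah].
by move=> g Ag B BP; have [[H _ HB] _] := BP; rewrite -HB;
   apply: carrierV; rewrite HB; exact: Ag.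
Qed.

Lemma generated_sub A : A `<=` generated A.
Proof. exact: sub_gen_smallest. Qed.

Lemma generated_sub_carrier A H : A `<=` carrier H -> generated A `<=` carrier H.
Proof. by apply: smallest_sub; exists H. Qed.

Definition lcoset g (C : set G) : set G := [set g * h | h in C].

Lemma lcoset1 C : lcoset 1 C = C.
Proof.
by apply/seteqP; split=> [_ [h Ch <-]|h Ch]; [rewrite mul1g | exists h; rewrite ?mul1g].
Qed.

Lemma lcosetM g h C : lcoset (g * h) C = lcoset g (lcoset h C).
Proof.
apply/seteqP; split=> [_ [k Ck <-]|_ [_ [k Ck <-] <-]].
  by exists (h * k); [exists k | rewrite mulgA].
by exists k; rewrite ?mulgA.
Qed.

Lemma mem_lcoset g h C : lcoset g C h <-> C (g^-1 * h).
Proof.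
split=> [[k Ck <-]|Ch]; first by rewrite mulKg.
by exists (g^-1 * h); rewrite ?mulVKg.
Qed.

Lemma lcoset_eq H g h :
  (lcoset g (carrier H) = lcoset h (carrier H)) <-> carrier H (g^-1 * h).
Proof.
split=> [gh|Hgh].
  by apply/mem_lcoset; rewrite gh; apply/mem_lcoset; rewrite mulVg; exact: carrier1.
apply/seteqP; split=> k /mem_lcoset Hk; apply/mem_lcoset.
  have -> : h^-1 * k = (g^-1 * h)^-1 * (g^-1 * k) by rewrite invgM invgK mulgA mulgK.
  by apply: carrierM => //; exact: carrierV.
have -> : g^-1 * k = (g^-1 * h) * (h^-1 * k) by rewrite mulgA mulgK.
exact: carrierM.
Qed.

Lemma left_cosetsE H : left_cosets H = range (fun g => lcoset g (carrier H)).
Proof. by []. Qed.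

Lemma lcoset_id H g : carrier H g -> lcoset g (carrier H) = carrier H.
Proof.
by move=> Hg; rewrite -[RHS]lcoset1; apply/lcoset_eq; rewrite mulg1; exact: carrierV.
Qed.

Lemma subgroup_fi_setT H : carrier H = setT -> subgroup_fi H.
Proof.
move=> HT; apply: (@sub_finite_set _ _ [set carrier H]); last exact: finite_set1.
by rewrite left_cosetsE => _ [g _ <-] /=; apply: lcoset_id; rewrite HT.
Qed.

Lemma subgroup_fiI H K L : carrier L = carrier H `&` carrier K ->
  subgroup_fi H -> subgroup_fi K -> subgroup_fi L.
Proof.
move=> LE fiH fiK.
apply: (@sub_finite_set _ _ [set C `&` D | C in left_cosets H & D in left_cosets K]).
  rewrite !left_cosetsE => _ [g _ <-].
  exists (lcoset g (carrier H)); first by exists g.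
  exists (lcoset g (carrier K)); first by exists g.
  rewrite LE; apply/seteqP; split=> h.
    by move=> [/mem_lcoset ? /mem_lcoset ?]; apply/mem_lcoset.
  by move=> /mem_lcoset [? ?]; split; apply/mem_lcoset.
exact: finite_image2.
Qed.

(** Each element of [E] outside [H] is missed by a member of the family that LERF provides;
    intersecting these finitely many members keeps the index finite. *)
Lemma LERF_separates H (E : seq G) : LERF G -> finitely_generated (carrier H) ->
  exists K, [/\ subgroup_fi K, carrier H `<=` carrier K &
    {in E, forall g, carrier K g -> carrier H g}].
Proof.
move=> lerf fgH; have [F Ffi HF] := lerf H fgH.
elim: E => [|g E [K [fiK HK EK]]].
  have [//|//|//|T TE] := @subgroup_exists setT.
  by exists T; split=> //; [exact: subgroup_fi_setT | rewrite TE].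
have [Hg|nHg] := pselect (carrier H g).
  by exists K; split=> // h; rewrite inE => /orP[/eqP-> //|]; exact: EK.
have [L FL nLg] : exists2 L, F L & ~ carrier L g.
  apply: contrapT => noL; apply: nHg; rewrite HF => L FL.
  by apply: contrapT => nLg; apply: noL; exists L.
have [|||M ME] := @subgroup_exists (carrier K `&` carrier L).
- by split; exact: carrier1.
- by move=> x y [? ?] [? ?]; split; exact: carrierM.
- by move=> x [? ?]; split; exact: carrierV.
exists M; split; first exact: (subgroup_fiI ME fiK (Ffi _ FL)).
  by rewrite ME subsetI; split=> //; rewrite HF; exact: bigcap_inf.
move=> h; rewrite ME inE => /orP[/eqP-> [_ /nLg //]|Eh [/EK Kh _]]; exact: Kh.
Qed.

End Subgroup.

(** * Neighbourhood bases given by finite data, and actions as representations *)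

Lemma eval_continuous_subtype_ptws (I : eqType) (T : topologicalType)
    (A : set {ptws I -> T}) (i : I) :
  continuous (fun g : A => (\val g : I -> T) i).
Proof.
move=> f; apply: (@continuous_comp _ {ptws I -> T} _ (@set_val _ A) (fun g => g i)).
  exact: initial_continuous.
exact: proj_continuous.
Qed.

Lemma cvg_subtype_ptws (I : Type) (T : topologicalType) (A : set {ptws I -> T})
    (F : set_system A) (f : A) : Filter F ->
  (forall i, (fun g : A => (\val g : I -> T) i) @ F --> (\val f : I -> T) i) -> F --> f.
Proof.
move=> FF Ff.
have valF : (\val : A -> {ptws I -> T}) @ F --> (\val f : {ptws I -> T}).
  apply/cvg_sup => i B; rewrite nbhsE => -[_ [[C oC <-] Cf] CB].
  by apply: filterS CB _; apply: Ff; exact: open_nbhs_nbhs.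
move=> B; rewrite nbhsE => -[_ [[C oC <-] Cf] CB].
by apply: filterS CB _; apply: valF; exact: open_nbhs_nbhs.
Qed.

Section Topology.
Variable G : groupType.

Definition subgroup_agree (H : subgroup G) (E : seq G) : set (subgroup G) :=
  [set K | {in E, forall g, carrier K g <-> carrier H g}].

Lemma subgroup_agree_nbhs (H : subgroup G) (E : seq G) :
  nbhs H (subgroup_agree H E).
Proof.
elim: E => [|g E IH]; first by apply: filterE => K g /=; rewrite in_nil.
have gH : nbhs H [set K : subgroup G | carrier K g <-> carrier H g].
  have gcont := @eval_continuous_subtype_ptws G bool _ g H.
  have nH : nbhs H [set K : subgroup G | (\val K : G -> bool) g = (\val H : G -> bool) g].
    exact: (gcont _ (@discrete_set1 bool ((\val H : G -> bool) g))).
  apply: (@filterS _ (nbhs H) _ _ _ _ nH).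
  by move=> K /= KHg; rewrite /carrier /= KHg.
apply: filterS (filterI gH IH) => K [Kg KE] h.
by rewrite inE => /orP[/eqP-> //|]; exact: KE.
Qed.

Lemma nbhs_subgroup_agree (H : subgroup G) (U : set (subgroup G)) :
  nbhs H U -> exists E, subgroup_agree H E `<=` U.
Proof.
(* Convergence to [H] of the filter generated by these sets puts one of them inside every
   neighbourhood of [H]. *)
pose F := filter_from [set: seq G] (subgroup_agree H).
have FF : Filter F.
  apply: filter_from_filter; first by exists [::].
  move=> E E' _ _; exists (E ++ E') => // K KE.
  by split=> g gE; apply: KE; rewrite mem_cat gE ?orbT.
have FH : F --> H.
  apply: cvg_subtype_ptws => g B /nbhs_singleton BH.
  exists [:: g] => // K /(_ g (mem_head _ _)) KH; rewrite /= /preimage/=.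
  suff -> : (\val K : G -> bool) g = (\val H : G -> bool) g by [].
  by apply/idP/idP => /KH.
by move=> /FH [E _ EU]; exists E.
Qed.

Variable X : choiceType.

Definition rep_agree (phi : permRep G X) (l : seq (G * X)) : set (permRep G X) :=
  [set psi : permRep G X | {in l, forall p, psi p.1 p.2 = phi p.1 p.2}].

Lemma rep_agree_nbhs (phi : permRep G X) l : nbhs phi (rep_agree phi l).
Proof.
elim: l => [|[g x] l IH]; first by apply: filterE => psi p /=; rewrite in_nil.
have gphi : nbhs phi [set psi : permRep G X | psi g x = phi g x].
  have xphi : nbhs (phi g) [set a : permutation X | a x = phi g x].
    exact: (@eval_continuous_subtype_ptws X (discrete_topology X) _ x (phi g)
      _ (@discrete_set1 (discrete_topology X) (phi g x))).
  exact: (@eval_continuous_subtype_ptws G (permutation X) _ g phi _ xphi).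
apply: filterS (filterI gphi IH) => psi [psig psil] p.
by rewrite inE => /orP[/eqP-> //|]; exact: psil.
Qed.

Lemma nbhs_rep_agree (phi : permRep G X) (U : set (permRep G X)) :
  nbhs phi U -> exists l, rep_agree phi l `<=` U.
Proof.
pose F := filter_from [set: seq (G * X)] (rep_agree phi).
have FF : Filter F.
  apply: filter_from_filter; first by exists [::].
  move=> E E' _ _; exists (E ++ E') => // K KE.
  by split=> g gE; apply: KE; rewrite mem_cat gE ?orbT.
have FH : F --> phi.
  (* Pointwise convergence is unfolded twice, over [G] and then over [X]. *)
  apply: cvg_subtype_ptws => g; apply: cvg_subtype_ptws => x B /nbhs_singleton BH.
  exists [:: (g, x)] => // psi /(_ (g, x) (mem_head _ _)) /= psi_phi.
  by rewrite /= /preimage /= -/(perm_fun _) -/(rep_fun _ _) psi_phi.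
by move=> /FH [E _ EU]; exists E.
Qed.

Lemma open_rep (W : set (permRep G X)) :
  (forall phi, W phi -> exists l, rep_agree phi l `<=` W) -> open W.
Proof.
move=> Wl; rewrite openE => phi /Wl [l lW].
exact: filterS lW (rep_agree_nbhs phi l).
Qed.

Lemma rep_agree_trans (phi psi : permRep G X) l l' : {subset l <= l'} -> rep_agree phi l psi ->
  rep_agree psi l' `<=` rep_agree phi l.
Proof. by move=> ll' psiP chi chiP p pl; rewrite chiP ?ll' // psiP. Qed.

Lemma open_rep_agree (phi : permRep G X) l : open (rep_agree phi l).
Proof. by apply: open_rep => psi psiP; exists l; exact: rep_agree_trans. Qed.

Lemma rep1 (phi : permRep G X) x : phi 1 x = x.
Proof.
apply: (bij_inj (perm_bij (phi 1))).
by rewrite -[in RHS](mulg1 1) rep_morph.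
Qed.

Lemma repM (phi : permRep G X) g h x : phi (g * h) x = phi g (phi h x).
Proof. by rewrite rep_morph. Qed.

Lemma repK (phi : permRep G X) g : cancel (phi g) (phi g^-1).
Proof. by move=> x; rewrite -repM mulVg rep1. Qed.

Lemma repVK (phi : permRep G X) g : cancel (phi g^-1) (phi g).
Proof. by move=> x; rewrite -repM mulgV rep1. Qed.

Lemma rep_exists (act : G -> X -> X) : (forall x, act 1 x = x) ->
    (forall g h x, act (g * h) x = act g (act h x)) ->
  exists phi : permRep G X, forall g x, phi g x = act g x.
Proof.
move=> act1 actM.
have bij_act g : bijective (act g).
  by exists (act g^-1) => x; rewrite -actM ?mulVg ?mulgV act1.
have act_morph : {morph (fun g => mk_perm (bij_act g)) : x y / x * y}.
  by move=> g h; apply: perm_ext => x; exact: actM.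
by exists (exist _ (fun g => mk_perm (bij_act g)) (mem_set act_morph)).
Qed.

Lemma stabilizer_subgroup (phi : permRep G X) x :
  exists H, carrier H = [set g | phi g x = x].
Proof.
apply: subgroup_exists => /=; first exact: rep1.
  by move=> g h gx hx; rewrite repM hx.
by move=> g {1}<-; rewrite repK.
Qed.

(** Orbit-stabilizer: a left coset of [H] consists of the elements sending [x] to one given point of
    its orbit. *)
Lemma stabilizer_fi (phi : permRep G X) x H : finite_set (rep_orbit phi x) ->
  carrier H = [set g | phi g x = x] -> subgroup_fi H.
Proof.
move=> fin HE.
apply: (@sub_finite_set _ _ ((fun y => [set g | phi g x = y]) @` rep_orbit phi x)).
  rewrite left_cosetsE => _ [g _ <-]; exists (phi g x); first by exists g.
  apply/seteqP; split=> h /=.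
    by move=> hg; apply/mem_lcoset; rewrite HE /= repM hg repK.
  by move=> /mem_lcoset; rewrite HE /= repM => ghx; rewrite -[in RHS]ghx repVK.
exact: finite_image.
Qed.

Lemma conj_repE a (phi : permRep G X) g x :
  conj_rep a phi g x = a (phi g (perm_inv a x)).
Proof. by []. Qed.

Lemma conj_rep_orbit_finite a (phi : permRep G X) x :
  finite_set (rep_orbit phi (perm_inv a x)) ->
  finite_set (rep_orbit (conj_rep a phi) x).
Proof.
move=> fin; apply: (@sub_finite_set _ _ (a @` rep_orbit phi (perm_inv a x))).
  by move=> _ [g _ <-]; exists (phi g (perm_inv a x)) => //; exists g.
exact: finite_image.
Qed.

End Topology.

(** * Enumerations, dependent choice, and construction of bijections *)

Lemma countable_enum (T : choiceType) (A : set T) (x0 : T) : A x0 ->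
  countable A ->
  exists c : nat -> T, (forall n, A (c n)) /\ forall x, A x -> exists n, c n = x.
Proof.
move=> Ax0 /countable_injP[f f_inj].
exists (fun n => xget x0 [set x | A x /\ f x = n]); split=> [n|x Ax].
  by case: xgetP => [x _ [] //|_].
exists (f x); case: xgetP => [y _ [Ay fyx]|/(_ x)[] //].
by apply: f_inj; rewrite ?inE.
Qed.

(** Dependent choice with an invariant [P] and a relation that depends on the stage. *)
Lemma stage_choice (T : Type) (P : T -> Prop) (Q : nat -> T -> T -> Prop) (x0 : T) :
    P x0 -> (forall n x, P x -> exists2 y, P y & Q n x y) ->
  exists f : nat -> T, f 0%N = x0 /\ forall n, P (f n) /\ Q n (f n) (f n.+1).
Proof.
move=> Px0 step.
have [p|s sP] := @choice _ _ (fun p y => P p.2 -> P y /\ Q p.1 p.2 y).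
  case: p => n x /=; have [Px|nPx] := pselect (P x); last by exists x.
  by have [y Py Qy] := step n x Px; exists y.
pose f := fix f n := if n is m.+1 then s (m, f m) else x0.
have Pf n : P (f n) by elim: n => //= n IH; have [] := sP (n, f n) IH.
by exists f; split=> // n; split=> //; have [] := sP (n, f n) (Pf n).
Qed.

(** The complements of [D] and of its image are both countably infinite, so a bijection between them
    completes [j]. *)
Lemma extend_injection (X Y : choiceType) (D : seq X) (j : X -> Y) :
    [set: X] #= [set: nat] -> [set: Y] #= [set: nat] ->
    {in D &, injective j} ->
  exists2 a : X -> Y, bijective a & {in D, a =1 j}.
Proof.
move=> Xnat Ynat j_inj.
have co_nat (Z : choiceType) (B : set Z) : [set: Z] #= [set: nat] -> finite_set B ->
    [set: Z] `\` B #= [set: nat].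
  move=> Znat finB; apply: eq_card_nat.
    apply: (sub_countable (card_leT _)).
    by rewrite (eq_countable Znat); exact: countableP.
  apply: infinite_setD finB; rewrite (eq_finite_set Znat).
  exact: infinite_nat.
have bij_j : set_bij [set` D] (j @` [set` D]) j.
  by apply: inj_bij => x y; rewrite !inE; exact: j_inj.
have [|||a aj] := @super_bij _ _ [set` D] [set: X] (j @` [set` D]) [set: Y] bij_j.
- by [].
- by [].
- apply: card_eq_trans (co_nat _ _ Xnat (finite_seq _)) _.
  rewrite card_eq_sym; apply: co_nat => //; apply: finite_image.
  exact: finite_seq.
exists a; first by rewrite -setTT_bijective.
by move=> x xD; apply: aj; rewrite inE.
Qed.

(** Stage [n] adds the [n]-th point of [X] to the domain and the [n]-th point of [Y] to the range;
    the union of the stages is the graph of [a]. The last clause lets properties of members of [P],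
    such as equivariance, pass to [a]. *)
Lemma back_and_forth (X Y : choiceType) (P : set (set (X * Y))) (x0 : X) (y0 : Y) :
    countable [set: X] -> countable [set: Y] -> P set0 ->
    (forall R x y x' y', P R -> R (x, y) -> R (x', y') -> x = x' <-> y = y') ->
    (forall R x, P R -> exists R', [/\ P R', R `<=` R' & exists y, R' (x, y)]) ->
    (forall R y, P R -> exists R', [/\ P R', R `<=` R' & exists x, R' (x, y)]) ->
  exists2 a : X -> Y, bijective a &
    forall x, exists R, [/\ P R, R (x, a x) & forall z w, R (z, w) -> w = a z].
Proof.
move=> cX cY P0 Pfun forth back.
have [u [_ u_surj]] := @countable_enum X setT x0 Logic.I cX.
have [v [_ v_surj]] := @countable_enum Y setT y0 Logic.I cY.
have [n R PR|f [_ fP]] := @stage_choice _ P (fun n R R' =>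
  [/\ R `<=` R', exists y, R' (u n, y) & exists x, R' (x, v n)]) set0 P0.
  have [R1 [PR1 RR1 [y R1y]]] := forth R (u n) PR.
  have [R2 [PR2 R12 xR2]] := back R1 (v n) PR1.
  exists R2 => //; split=> //; first exact: subset_trans R12.
  by exists y; exact: R12.
have f_mono m n : (m <= n)%N -> f m `<=` f n.
  elim: n => [|n IH]; first by rewrite leqn0 => /eqP->.
  rewrite leq_eqVlt => /predU1P[-> //|/IH fmn].
  by apply: subset_trans fmn _; have [_ []] := fP n.
have f_fun m n x y x' y' : f m (x, y) -> f n (x', y') -> x = x' <-> y = y'.
  move=> fm fn; apply: (Pfun (f (maxn m n))); first by have [] := fP (maxn m n).
    exact: f_mono (leq_maxl _ _) _ fm.
  exact: f_mono (leq_maxr _ _) _ fn.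
have [x|a aP] := @choice _ _ (fun x y => exists n, f n (x, y)).
  have [n <-] := u_surj x Logic.I.
  by have [_ [_ [y fy] _]] := fP n; exists y, n.+1.
have [y|b bP] := @choice _ _ (fun y x => exists n, f n (x, y)).
  have [n <-] := v_surj y Logic.I.
  by have [_ [_ _ [x fx]]] := fP n; exists x, n.+1.
exists a.
  exists b => [x|y].
    by have [n fn] := aP x; have [m fm] := bP (a x); apply/(f_fun _ _ _ _ _ _ fm fn).
  by have [n fn] := bP y; have [m fm] := aP (b y); apply/(f_fun _ _ _ _ _ _ fm fn).
move=> x; have [n fn] := aP x; exists (f n); split=> //; first by have [] := fP n.
by move=> z w fzw; have [m fm] := aP z; apply/(f_fun _ _ _ _ _ _ fzw fm).
Qed.

(** * Finitely generated groups: countability and finite index subgroups *)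

Section FinitelyGenerated.
Variable G : groupType.
Hypothesis G_fg : finitely_generated [set: G].

Lemma fg_seq : exists S : seq G, [set: G] = generated [set` S].
Proof. by have [B /finite_seqP[S ->] ->] := G_fg; exists S. Qed.

Lemma fg_countable : countable [set: G].
Proof.
have [S GS] := fg_seq.
pose S' := S ++ [seq g^-1 | g <- S].
(* Words are sequences of indices into [S']; an index out of range contributes the default [1], so
   every sequence is a word. *)
pose f (w : seq nat) := foldr (fun i g => nth 1 S' i * g) 1 w.
have fcat w1 w2 : f (w1 ++ w2) = f w1 * f w2.
  by elim: w1 => [|i w IH]; rewrite /= ?mul1g // -mulgA -IH.
have fS' g : g \in S' -> exists i, f [:: i] = g.
  by move=> gS; exists (index g S'); rewrite /f /= nth_index // mulg1.
have S'V i : exists j, nth 1 S' j = (nth 1 S' i)^-1.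
  have [iS|Si] := ltnP i (size S'); last by exists i; rewrite nth_default ?invg1.
  have : (nth 1 S' i)^-1 \in S'.
    have := mem_nth 1 iS; rewrite {2}/S' !mem_cat => /orP[gS|/mapP[g gS ->]].
      by rewrite map_f ?orbT.
    by rewrite invgK gS.
  by move=> gS; exists (index (nth 1 S' i)^-1 S'); rewrite nth_index.
have Gf : [set: G] `<=` range f.
  rewrite GS; apply: generated_min => [|_ _ [w1 _ <-] [w2 _ <-]|_ [w _ <-]|h hS].
  - by exists [::].
  - by exists (w1 ++ w2).
  - elim: w => [|i w [w' _ IH]] /=; first by exists [::]; rewrite //= invg1.
    have [k kV] := S'V i; exists (w' ++ [:: k]) => //.
    by rewrite fcat IH /= mulg1 kV invgM.
  - by have [|k <-] := @fS' h; [rewrite mem_cat hS | exists [:: k]].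
apply: sub_countable (subset_card_le Gf) _.
by apply: sub_countable (card_image_le f _) _; exact: countableP.
Qed.

(* Schreier's lemma: if [R] is a finite set of representatives of the cosets of
   [K] and [L] is generated by the elements [x^-1 * g * y] of [K] with [x], [y]
   in [R] and [g] a generator or its inverse, then [R * L] is stable under the
   generators, hence is [G]. *)
Lemma fi_finitely_generated (K : subgroup G) : subgroup_fi K ->
  finitely_generated (carrier K).
Proof.
move=> fiK; have [S GS] := fg_seq.
have [C|r rP] :=
    @choice _ _ (fun C g => left_cosets K C -> lcoset g (carrier K) = C).
  have [[g _ <-]|nC] := pselect (left_cosets K C); last by exists 1.
  by exists g.
pose R := r @` left_cosets K.
have finR : finite_set R by exact: finite_image.
have Rrep g : exists2 x, R x & carrier K (x^-1 * g).
  have Kg : left_cosets K (lcoset g (carrier K)) by exists g.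
  exists (r (lcoset g (carrier K))); first by exists (lcoset g (carrier K)).
  by apply/lcoset_eq; rewrite rP.
pose S' := [set` S ++ [seq g^-1 | g <- S]].
(* [R] is included so that a representative lying in [K] belongs to [L], as the last step
   requires. *)
pose E := [set x^-1 * z | x in R & z in [set g * y | g in S' & y in R]] `|` R.
have finE : finite_set E.
  rewrite finite_setU; split=> //; apply: finite_image2 => //.
  by apply: finite_image2 => //; exact: finite_seq.
exists (E `&` carrier K); first exact: finite_setIl.
have [L LE] := generated_subgroup (E `&` carrier K).
have LK : carrier L `<=` carrier K by rewrite LE; apply: generated_sub_carrier => ? [].
have EL g : E g -> carrier K g -> carrier L g.
  by move=> *; rewrite LE; apply: generated_sub.
pose W := [set g | exists2 x, R x & carrier L (x^-1 * g)].
have WS g h : S' g -> W h -> W (g * h).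
  move=> Sg [x Rx Lh]; have [y Ry Ky] := Rrep (g * x).
  exists y => //.
  have -> : y^-1 * (g * h) = (y^-1 * (g * x)) * (x^-1 * h).
    by rewrite !mulgA mulgK.
  apply: carrierM => //; apply: EL => //; left.
  by exists y => //; exists (g * x) => //; exists g => //; exists x.
(* Treating [g] and its inverse together makes the induction predicate closed under inversion. *)
have WG g : (forall h, W h -> W (g * h)) /\ (forall h, W h -> W (g^-1 * h)).
  have : [set: G] g by [].
  rewrite GS; move: g; apply: generated_min => [|g h [g1 g2] [h1 h2]|g [g1 g2]|g gS].
  - by split=> h; rewrite ?invg1 mul1g.
  - split=> k Wk; rewrite ?invgM -mulgA; first exact/g1/h1.
    exact/h2/g2.
  - by rewrite /= invgK.
  - split=> h; apply: WS; rewrite /S' /= mem_cat ?gS //.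
    by rewrite map_f ?orbT.
have [w Rw Kw] := Rrep 1.
have Ww : W w by exists w => //; rewrite mulVg; exact: carrier1.
have WT g : W g by have [+ _] := WG (g * w^-1); move=> /(_ _ Ww); rewrite mulgVK.
rewrite -LE; apply/seteqP; split=> // k Kk.
(* Here [k] is [x] times an element of [L], so [x] lies in both [K] and [R], hence in [L]. *)
have [x Rx Lx] := WT k; rewrite -(mulVKg x k); apply: carrierM => //.
apply: EL; first by right.
have -> : x = k * (x^-1 * k)^-1 by rewrite invgM invgK mulVKg.
by apply: carrierM => //; apply/carrierV/LK.
Qed.

(** Finite index subgroups are finitely generated, and a countable group has only countably many
    finite subsets. *)
Lemma fi_enumeration : exists E : nat -> subgroup G,
  (forall n, subgroup_fi (E n)) /\ forall K, subgroup_fi K -> exists n, E n = K.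
Proof.
have [//|//|//|T TE] := @subgroup_exists G setT.
apply: (@countable_enum _ _ T); first exact: subgroup_fi_setT.
have [gen genE] := choice (@generated_subgroup G).
apply: (@sub_countable _ _ _ [set A : set G | A `<=` setT /\ finite_set A]).
  apply: card_le_trans (card_image_le gen _).
  apply: subset_card_le => K /fi_finitely_generated[B finB KB].
  by exists B => //; apply: subgroup_ext; rewrite genE.
exact/countable_finite_subset/fg_countable.
Qed.

End FinitelyGenerated.

(** * Coset representations, open conditions on finite orbits, and conjugacy *)

Section Representations.
Variables (G : groupType) (X : choiceType).
Hypothesis G_fg : finitely_generated [set: G].
Hypothesis X_nat : [set: X] #= [set: nat].

(* [pt i h] is the coset [h (K i)] in the disjoint union of the [G / K i]. *)
Lemma coset_rep (I : pointedType) (K : I -> subgroup G) :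
    countable [set: I] -> infinite_set [set: I] ->
  exists (phi : permRep G X) (pt : I -> G -> X),
    [/\ forall i g h, phi g (pt i h) = pt i (g * h),
        forall i j g h, pt i g = pt j h -> i = j /\ carrier (K i) (g^-1 * h),
        forall i g h, carrier (K i) (g^-1 * h) -> pt i g = pt i h &
        forall x, exists i h, x = pt i h].
Proof.
move=> cI infI.
(* Tagging cosets by their index makes the union disjoint; the action on [A] is then carried to [X]
   by a bijection [f] with inverse [q]. *)
pose A := [set p : I * set G | exists h, p.2 = lcoset h (carrier (K p.1))].
have cA : countable A.
  pose c (p : I * G) := (p.1, lcoset p.2 (carrier (K p.1))).
  have Ac : A `<=` c @` ([set: I] `*` [set: G]).
    by move=> [i C] [h /= ->]; exists (i, h).
  apply: sub_countable (subset_card_le Ac) _.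
  apply: sub_countable (card_image_le _ _) _.
  by apply: countableX => //; exact: fg_countable.
have infA : infinite_set A.
  move=> /(finite_image fst); apply: contra_not infI; apply: sub_finite_set => i _.
  by exists (i, carrier (K i)) => //; exists 1; rewrite lcoset1.
have /card_set_bijP[f [fA f_inj f_surj]] : [set: X] #= A.
  by apply: card_eq_trans X_nat _; rewrite card_eq_sym; exact: eq_card_nat.
have [p|q qP] := @choice _ _ (fun p x => A p -> f x = p).
  have [Ap|nAp] := pselect (A p); last first.
    have [x _ _] := f_surj (point, carrier (K point)) (ex_intro _ 1 (esym (lcoset1 _))).
    by exists x.
  by have [x _ fx] := f_surj p Ap; exists x.
have fq x : q (f x) = x.
  by apply: f_inj; rewrite ?inE //; apply: qP; exact: fA.
pose act g (p : I * set G) := (p.1, lcoset g p.2).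
have actA g p : A p -> A (act g p).
  by move=> [h pE]; exists (g * h); rewrite /= pE lcosetM.
have [x|g h x|phi phiE] := @rep_exists G X (fun g x => q (act g (f x))).
- by rewrite /act lcoset1 -surjective_pairing fq.
- by rewrite qP /act /= ?lcosetM //; apply: actA; exact: fA.
pose c i h := (i, lcoset h (carrier (K i))).
have Ac i h : A (c i h) by exists h.
exists phi, (fun i h => q (c i h)); split=> [i g h|i j g h|i g h Kgh|x].
- by rewrite phiE qP // /act /c /= lcosetM.
- move=> /(congr1 f); rewrite !qP // => -[<- /lcoset_eq]; by [].
- by rewrite /c; congr (q (i, _)); apply/lcoset_eq.
- have [h fxE] := fA x Logic.I; exists (f x).1, h.
  by rewrite /c -fxE -surjective_pairing fq.
Qed.

(** The values of the generators on the invariant set [rep_orbit phi x] determine those of all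
    words, and they are finite in number. *)
Lemma finite_orbit_agree (phi : permRep G X) x : finite_set (rep_orbit phi x) ->
  exists l, forall psi, rep_agree phi l psi -> forall g, psi g x = phi g x.
Proof.
have [S GS] := fg_seq G_fg.
move=> /finite_seqP[O OE]; exists [seq (g, y) | g <- S, y <- O] => psi psiP g.
suff [+ _] : (forall y, rep_orbit phi x y -> psi g y = phi g y) /\
  (forall y, rep_orbit phi x y -> psi g^-1 y = phi g^-1 y).
  by apply; exists 1 => //; rewrite rep1.
have orb h y : rep_orbit phi x y -> rep_orbit phi x (phi h y).
  by move=> [k _ <-]; exists (h * k); rewrite ?repM.
have : [set: G] g by [].
rewrite GS; move: g; apply: generated_min => [|g h [g1 g2] [h1 h2]|g [g1 g2]|g gS].
- by split=> y _; rewrite ?invg1 !rep1.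
- split=> y Oy; rewrite ?invgM !repM.
    by rewrite h1 // g1 //; exact: orb.
  by rewrite g2 // h2 //; exact: orb.
- by rewrite /= invgK.
have psig y : rep_orbit phi x y -> psi g y = phi g y.
  rewrite OE => Oy; apply: (psiP (g, y)).
  by apply/allpairsP; exists (g, y).
split=> // y Oy; apply: (can_inj (repK psi g)).
by rewrite repVK psig ?repVK //; exact: orb.
Qed.

Lemma open_finite_orbit x :
  open [set phi : permRep G X | finite_set (rep_orbit phi x)].
Proof.
apply: open_rep => phi /= fin; have [l lP] := finite_orbit_agree fin.
exists l => psi /lP psiE; apply: sub_finite_set fin => _ [g _ <-].
by exists g; rewrite ?psiE.
Qed.

Lemma open_stabilizer x (K : set G) :
  open [set phi : permRep G X | finite_set (rep_orbit phi x) /\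
          [set g | phi g x = x] = K].
Proof.
apply: open_rep => phi /= [fin <-]; have [l lP] := finite_orbit_agree fin.
exists l => psi /lP psiE; split.
  by apply: sub_finite_set fin => _ [g _ <-]; exists g; rewrite ?psiE.
by apply/seteqP; split=> g /=; rewrite psiE.
Qed.

Variable E : nat -> subgroup G.
Hypothesis E_fi : forall n, subgroup_fi (E n).
Hypothesis E_surj : forall K, subgroup_fi K -> exists n, E n = K.
Variables (e : X -> nat) (d : nat -> X).
Hypothesis eK : cancel e d.

(* [m] has two roles: it selects the point [d m], and it bounds the index of [y]
   from below, so that [y] avoids any given finite set when [m] is large. *)
Definition abundant (m n : nat) : set (permRep G X) :=
  [set phi | finite_set (rep_orbit phi (d m)) /\ exists y, (m <= e y)%N /\
    (finite_set (rep_orbit phi y) /\ [set g | phi g y = y] = carrier (E n))].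

Lemma open_abundant m n : open (abundant m n).
Proof.
have -> : abundant m n = [set phi | finite_set (rep_orbit phi (d m))] `&`
  \bigcup_(y in [set y | (m <= e y)%N])
    [set phi : permRep G X | finite_set (rep_orbit phi y) /\
       [set g | phi g y = y] = carrier (E n)].
  apply/seteqP; split=> phi [fin].
    by move=> [y [my yP]]; split=> //; exists y.
  by move=> [y my yP]; split=> //; exists y.
apply: openI; first exact: open_finite_orbit.
by apply: bigcup_open => y _; exact: open_stabilizer.
Qed.

Lemma bounded_finite (B : set X) : finite_set B ->
  exists m, forall y, B y -> (e y < m)%N.
Proof.
move=> /finite_seqP[s ->]; elim: s => [|x s [m ms]]; first by exists 0%N.
exists (maxn (e x).+1 m) => y /=; rewrite inE leq_max => /orP[/eqP-> |/ms ->].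
  by rewrite ltnSn.
by rewrite orbT.
Qed.

(** Graphs of equivariant bijections between finite invariant subsets. *)
Definition matching (phi psi : permRep G X) : set (set (X * X)) :=
  [set R | [/\ finite_set R,
    forall x y x' y', R (x, y) -> R (x', y') -> x = x' <-> y = y' &
    forall g x y, R (x, y) -> R (phi g x, psi g y)]].

Definition flip (R : set (X * X)) : set (X * X) := [set p | R (p.2, p.1)].

Lemma matching_flip phi psi R : matching phi psi R -> matching psi phi (flip R).
Proof.
move=> [finR funR actR]; split=> [|x y x' y' Rxy Rx'y'|g x y]; last exact: actR.
  apply: (@sub_finite_set _ _ ((fun p => (p.2, p.1)) @` R)).
    by move=> [x y] /= Rxy; exists (y, x).
  exact: finite_image.
by have [] := funR _ _ _ _ Rxy Rx'y'.
Qed.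

(** Abundance of [psi] supplies a point [y] outside the range of [R] with the same stabilizer as
    [x]; the orbits of [x] and [y] are then matched equivariantly. *)
Lemma matching_forth phi psi R x :
    (forall m n, abundant m n phi) -> (forall m n, abundant m n psi) ->
    matching phi psi R ->
  exists R', [/\ matching phi psi R', R `<=` R' & exists y, R' (x, y)].
Proof.
move=> aphi apsi [finR funR actR].
have [[y Rxy]|nRx] := pselect (exists y, R (x, y)).
  by exists R; split=> //; exists y.
have finx : finite_set (rep_orbit phi x).
  by have [] := aphi (e x) 0%N; rewrite eK.
have [H HE] := stabilizer_subgroup phi x.
have [n EnH] := E_surj (stabilizer_fi finx HE).
(* This [m] exceeds the indices of all points in the range of [R], which forces [y] to be new. *)
have [m mP] := bounded_finite (finite_image snd finR).
have [_ [y [my [finy yE]]]] := apsi m n.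
have nRy z : ~ R (z, y).
  by move=> Rzy; have := mP y (ex_intro2 _ _ (z, y) Rzy erefl); rewrite ltnNge my.
have stab g : phi g x = x <-> psi g y = y.
  have : [set g | phi g x = x] g <-> [set g | psi g y = y] g.
    by rewrite yE EnH HE.
  by [].
have stab2 g h : phi g x = phi h x <-> psi g y = psi h y.
  have [s1 s2] := stab (h^-1 * g); rewrite !repM in s1 s2; split=> gh.
    by rewrite -[LHS](repVK psi h) s1 // gh repK.
  by rewrite -[LHS](repVK phi h) s2 // gh repK.
exists (R `|` range (fun g => (phi g x, psi g y))); split.
- split.
  + rewrite finite_setU; split=> //.
    apply: (@sub_finite_set _ _ (rep_orbit phi x `*` rep_orbit psi y)).
      by move=> _ [g _ <-]; split; exists g.
    exact: finite_setX.
  + move=> x1 y1 x2 y2 [R1|[g _ [<- <-]]] [R2|[h _ [<- <-]]].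
    * exact: funR.
    (* If [R] met one of the new orbits, translating back would give a pair of [R] containing [x] or
       [y]. *)
    * split=> E1; exfalso.
        by apply: nRx; exists (psi h^-1 y1); rewrite -(repK phi h x) -E1; exact: actR.
      by apply: (nRy (phi h^-1 x1)); rewrite -(repK psi h y) -E1; exact: actR.
    * split=> E1; exfalso.
        by apply: nRx; exists (psi g^-1 y2); rewrite -(repK phi g x) E1; exact: actR.
      by apply: (nRy (phi g^-1 x2)); rewrite -(repK psi g y) E1; exact: actR.
    * exact: stab2.
  + move=> g x1 y1 [R1|[h _ [<- <-]]]; first by left; exact: actR.
    by right; exists (g * h) => //; rewrite !repM.
- by move=> p Rp; left.
- by exists y; right; exists 1 => //; rewrite !rep1.
Qed.

Lemma abundant_conj phi psi :
    (forall m n, abundant m n phi) -> (forall m n, abundant m n psi) ->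
  conj_orbit phi psi.
Proof.
move=> aphi apsi.
have cX : countable [set: X] by rewrite (eq_countable X_nat); exact: countableP.
have [||R x|R y|a bij_a aP] :=
  @back_and_forth X X (matching phi psi) (d 0%N) (d 0%N) cX cX.
- by split.
- by move=> R x y x' y' [_ funR _]; exact: funR.
- exact: matching_forth.
- move=> /matching_flip /(@matching_forth _ _ _ y apsi aphi)[R' [mR' RR' [x xy]]].
  exists (flip R'); split; first exact: matching_flip.
    by move=> [u v] Ruv; exact: RR'.
  by exists x.
exists (mk_perm bij_a) => //.
apply: val_inj; apply: funext => g; apply: perm_ext => x.
set b := mk_perm bij_a; change (b (phi g (perm_inv b x)) = psi g x).
rewrite -{2}(perm_funK b x).
(* An invariant [R] inside the graph of [a] shows that [a] is equivariant at this point. *)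
have [R [[_ _ actR] Rx Ra]] := aP (perm_inv b x).
exact: esym (Ra _ _ (actR g _ _ Rx)).
Qed.

End Representations.

(** * The generic representation and the three implications *)

Lemma infinite_inj_image (T U : Type) (f : T -> U) (A : set T) :
  injective f -> infinite_set A -> infinite_set (f @` A).
Proof.
by move=> f_inj; rewrite (eq_finite_set (inj_card_eq (in2W f_inj))).
Qed.

Lemma permKV (X : choiceType) (a : permutation X) : cancel a (perm_inv a).
Proof. exact: perm_invK. Qed.

Lemma permVK (X : choiceType) (a : permutation X) : cancel (perm_inv a) a.
Proof. exact: perm_funK. Qed.

Section GenericRepresentation.
Variables (G : groupType) (X : choiceType).
Hypothesis G_fg : finitely_generated [set: G].
Hypothesis X_nat : [set: X] #= [set: nat].

(** Free of the enumerations in [abundant], this form is visibly invariant under conjugation. *)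
Definition universal (phi : permRep G X) : Prop :=
  (forall x, finite_set (rep_orbit phi x)) /\
  forall K, subgroup_fi K ->
    infinite_set [set y | [set g | phi g y = y] = carrier K].

Lemma universal_conj a phi : universal phi -> universal (conj_rep a phi).
Proof.
move=> [fin inf]; split=> [x|K /inf infK]; first exact/conj_rep_orbit_finite.
apply: sub_infinite_set (infinite_inj_image (bij_inj (perm_bij a)) infK).
move=> _ [y yK <-] /=; rewrite -yK; apply/seteqP; split=> g /=.
  by rewrite conj_repE permKV => /(bij_inj (perm_bij a)).
by rewrite conj_repE permKV => ->.
Qed.

Lemma universal_abundant (E : nat -> subgroup G) (e : X -> nat) (d : nat -> X) phi :
    cancel e d -> (forall n, subgroup_fi (E n)) -> universal phi ->
  forall m n, abundant E e d m n phi.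
Proof.
move=> eK E_fi [fin inf] m n; split; first exact: fin.
apply: contrapT => no; apply: (inf _ (E_fi n)).
(* Otherwise all points with stabilizer [E n] would have index below [m]. *)
apply: (@sub_finite_set _ _ (d @` `I_m)); last exact/finite_image/finite_II.
move=> y yE; exists (e y); last exact: eK.
by rewrite /= ltnNge; apply/negP => my; apply: no; exists y.
Qed.

(** In an index [(n, k)], [n] selects the subgroup [E n] and [k] numbers the copies of its coset
    space. *)
Lemma universal_exists (E : nat -> subgroup G) : (forall n, subgroup_fi (E n)) ->
    (forall K, subgroup_fi K -> exists n, E n = K) ->
  exists (phi : permRep G X) (pt : nat * nat -> G -> X),
    [/\ universal phi, forall i g h, phi g (pt i h) = pt i (g * h),
        forall i j g h, pt i g = pt j h -> i = j /\ carrier (E i.1) (g^-1 * h) &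
        forall i g h, carrier (E i.1) (g^-1 * h) -> pt i g = pt i h].
Proof.
move=> E_fi E_surj.
have [|phi [pt [ptM pt_inj pt_eq pt_surj]]] :=
  @coset_rep G X G_fg X_nat (nat * nat)%type (E \o fst) (countableP _).
  exact: infinite_prod_nat.
exists phi, pt; split=> //; split=> [x|K /E_surj[n <-]].
  have [i [h ->]] := pt_surj x.
  apply: (@sub_finite_set _ _ ((fun C => pt i (xget 1 C)) @` left_cosets (E i.1))).
    move=> _ [g _ <-]; rewrite ptM.
    exists (lcoset (g * h) (carrier (E i.1))); first by exists (g * h).
    case: xgetP => [k _ /mem_lcoset Ek|/(_ (g * h))[]].
      exact/esym/pt_eq.
    by apply/mem_lcoset; rewrite mulVg; exact: carrier1.
  by apply: finite_image; exact: E_fi.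
apply: (@sub_infinite_set _ ((fun k => pt (n, k) 1) @` [set: nat])).
  move=> _ [k _ <-]; apply/seteqP; split=> g /=; rewrite ptM mulg1.
    by move=> /esym/pt_inj[_]; rewrite invg1 mul1g.
  by move=> Eg; apply/esym/pt_eq; rewrite invg1 mul1g.
apply: infinite_inj_image infinite_nat.
by move=> k k' /pt_inj[[]].
Qed.

(* Along each orbit meeting the finite data [l], a stabilizer is replaced by a
   finite index subgroup with the same trace on the finitely many elements that
   govern [l], and the resulting finite pattern is found inside [tau]. *)
Lemma conj_orbit_dense (E : nat -> subgroup G) (tau : permRep G X)
    (pt : nat * nat -> G -> X) :
    (forall K, subgroup_fi K -> exists n, E n = K) ->
    (forall i g h, tau g (pt i h) = pt i (g * h)) ->
    (forall i j g h, pt i g = pt j h -> i = j /\ carrier (E i.1) (g^-1 * h)) ->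
    (forall i g h, carrier (E i.1) (g^-1 * h) -> pt i g = pt i h) ->
  dense (@subgroup_fi G) -> dense (conj_orbit tau).
Proof.
move=> E_surj ptM pt_inj pt_eq fi_dense U U0 openU.
have [phi Uphi] : exists phi : permRep G X, U phi := U0.
have [l lU] := nbhs_rep_agree (open_nbhs_nbhs (conj openU Uphi)).
have x0 : X := pt (0, 0)%N 1.
(* [r] picks one base point per orbit, and [t x] below moves that base point to [x]. *)
pose r x := xget x0 (rep_orbit phi x).
have rM g x : r (phi g x) = r x.
  rewrite /r; congr xget; apply/seteqP; split=> _ [h _ <-].
    by exists (h * g); rewrite ?repM.
  by exists (h * g^-1); rewrite ?repM ?repK.
have [x|t tr] := @choice _ _ (fun x g => phi g (r x) = x).
  rewrite /r; case: xgetP => [_ _ [g _ <-]|/(_ x)[]].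
    by exists g^-1; rewrite repK.
  by exists 1; rewrite ?rep1.
have [S SE] := choice (stabilizer_subgroup phi).
pose D := [seq p.2 | p <- l] ++ [seq phi p.1 p.2 | p <- l].
(* Membership of the first elements in a stabilizer decides equality of points of [D]; the second
   ones express the equations recorded in [l]. *)
pose F := [seq (t x)^-1 * t y | x <- D, y <- D] ++
          [seq (p.1 * t p.2)^-1 * t (phi p.1 p.2) | p <- l].
have [x|i iP] := @choice _ _ (fun x n => forall g, g \in F ->
    carrier (E n) g <-> phi g x = x).
  have := subgroup_agree_nbhs (S x) F; rewrite nbhsE => -[V [openV VS] VF].
  have [K [/VF KF /E_surj[n En]]] := fi_dense V (ex_intro _ _ VS) openV.
  exists n => g /KF; rewrite En => ->.
  by rewrite SE.
have /countable_injP[e e_inj] : countable [set: X].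
  by rewrite (eq_countable X_nat); exact: countableP.
(* The copy number [e (r x)] sends distinct orbits to distinct copies. *)
pose j x := pt (i (r x), e (r x)) (t x).
have j_inj : {in D &, injective j}.
  move=> x y xD yD /pt_inj[[_ exy] /= Eg].
  have rxy : r x = r y by apply: e_inj; rewrite ?inE.
  rewrite -(tr x) -[RHS](tr y) -rxy.
  have /iP : (t x)^-1 * t y \in F.
    by rewrite mem_cat; apply/orP; left; apply/allpairsP; exists (x, y).
  by move=> /(_ (r x))[/(_ Eg) + _]; rewrite repM => {1}<-; rewrite repVK.
have [a bij_a aj] := extend_injection X_nat X_nat j_inj.
pose b := mk_perm bij_a.
exists (conj_rep b^-1 tau); split; last by exists b^-1.
apply: lU => -[g x] gx_l.
have xD : x \in D by rewrite mem_cat; apply/orP; left; apply/mapP; exists (g, x).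
have gxD : phi g x \in D.
  by rewrite mem_cat; apply/orP; right; apply/mapP; exists (g, x).
apply: (bij_inj (perm_bij b)) => /=.
have -> : b (conj_rep b^-1 tau g x) = tau g (a x).
  have -> : conj_rep b^-1 tau g x = perm_inv b (tau g (perm_inv (perm_inv b) x)) by [].
  by rewrite permVK -[in RHS](permVK (perm_inv b) x) -[RHS]/(tau g (b _)) permVK.
rewrite aj // -[b _]/(a _) aj // /j ptM rM; apply: pt_eq => /=.
apply/iP.
  by rewrite mem_cat; apply/orP; right; apply/mapP; exists (g, x).
have tgx : phi (t (phi g x)) (r x) = phi (g * t x) (r x).
  by rewrite [RHS]repM tr -(rM g x) tr.
by rewrite repM tgx repK.
Qed.

(** Baire's argument on finite data: nested basic sets enter the [U n] one by one, and their centres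
    converge pointwise. *)
Lemma comeager_dense (A : set (permRep G X)) : comeager A -> dense A.
Proof.
move=> [U Uod UA] O O0 openO.
have [phi0 Ophi0] : exists phi : permRep G X, O phi := O0.
have [l0 l0O] := nbhs_rep_agree (open_nbhs_nbhs (conj openO Ophi0)).
have [x0 _] : [set: X] !=set0.
  by apply: infinite_setN0; rewrite (eq_finite_set X_nat); exact: infinite_nat.
have cGX : countable [set: G * X].
  rewrite -setXTT; apply: countableX; first exact: fg_countable.
  by rewrite (eq_countable X_nat); exact: countableP.
have [c [_ c_surj]] := @countable_enum _ setT (1, x0) Logic.I cGX.
have [n [phi l] _|f [f0 fP]] := @stage_choice (permRep G X * seq (G * X))%type
  (fun _ => True)
  (fun n s t => [/\ {subset s.2 <= t.2}, rep_agree s.1 s.2 t.1, c n \in t.2 &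
     rep_agree t.1 t.2 `<=` U n]) (phi0, l0) Logic.I.
  have [openU denseU] := Uod n.
  have [|psi [phi_psi Upsi]] := denseU (rep_agree phi l) _ (@open_rep_agree _ _ phi l).
    by exists phi.
  have [l1 l1U] := nbhs_rep_agree (open_nbhs_nbhs (conj openU Upsi)).
  (* [l] keeps the earlier constraints, [l1] confines to [U n], and [c n] freezes the value at the
     [n]-th pair. *)
  exists (psi, c n :: l ++ l1) => //; split=> //=.
  - by move=> p pl; rewrite inE mem_cat pl orbT.
  - by rewrite mem_head.
  - move=> chi chiP; apply: l1U => p pl; apply: chiP.
    by rewrite inE mem_cat pl !orbT.
have mono m n : (m <= n)%N -> {subset (f m).2 <= (f n).2} /\
    rep_agree (f m).1 (f m).2 (f n).1.
  elim: n => [|n IH]; first by rewrite leqn0 => /eqP->; split.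
  rewrite leq_eqVlt => /predU1P[->|/IH[sub agree]]; first by split.
  have [_ [sub' agree' _ _]] := fP n; split=> p pm; first exact/sub'/sub.
  by rewrite agree' ?sub // agree.
have [p|lim limP] := @choice _ _ (fun p y =>
    exists k, forall n, (k <= n)%N -> (f n).1 p.1 p.2 = y).
  have [k ck] := c_surj p Logic.I.
  exists ((f k.+1).1 p.1 p.2), k.+1 => n kn.
  have [_ agree] := mono _ _ kn; apply: agree.
  by have [_ []] := fP k; rewrite ck.
(* Each instance of an action law involves finitely many eventually constant values, so it passes to
   the limit; bijectivity follows from the laws. *)
have [x|g h x|psi psiE] := @rep_exists G X (fun g x => lim (g, x)).
- by have [k /(_ k (leqnn k)) <-] := limP (1, x); rewrite rep1.
- have [k1 k1P] := limP (g * h, x).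
  have [k2 k2P] := limP (h, x).
  have [k3 k3P] := limP (g, lim (h, x)).
  have [k [kk1 kk2 kk3]] : exists k, [/\ (k1 <= k)%N, (k2 <= k)%N & (k3 <= k)%N].
    by exists (maxn k1 (maxn k2 k3)); rewrite !leq_max !leqnn !orbT.
  by rewrite -(k1P k) // -(k3P k) // -(k2P k) //= repM.
have fpsi n : rep_agree (f n).1 (f n).2 psi.
  move=> [g x] pn; have [k kP] := limP (g, x).
  rewrite psiE -(kP (maxn n k)) ?leq_maxr //.
  by have [_ agree] := mono _ _ (leq_maxl n k); exact: agree.
exists psi; split.
  by apply: l0O; have := fpsi 0%N; rewrite f0.
by apply: UA => n _; have [_ [_ _ _]] := fP n; apply; exact: fpsi.
Qed.

Lemma dense_fi_generic : dense (@subgroup_fi G) ->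
  exists tau : permRep G X, (forall x, finite_set (rep_orbit tau x)) /\
    comeager (conj_orbit tau).
Proof.
move=> fi_dense; have [E [E_fi E_surj]] := fi_enumeration G_fg.
have [tau [pt [tau_univ ptM pt_inj pt_eq]]] := universal_exists E_fi E_surj.
have tau_dense := conj_orbit_dense E_surj ptM pt_inj pt_eq fi_dense.
have /card_set_bijP[e] := X_nat; rewrite setTT_bijective => -[d eK dK].
exists tau; split; first by have [] := tau_univ.
have [c _ c_surj] : exists2 c : nat -> nat * nat, True & forall p, exists n, c n = p.
  exists (fun n => odflt (0, 0)%N (unpickle n)) => // p.
  by exists (pickle p); rewrite pickleK.
exists (fun n => abundant E e d (c n).1 (c n).2) => [n|phi phiP].
  split; first exact: open_abundant.
  (* Every [abundant] set contains the dense conjugacy orbit of the universal [tau]. *)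
  move=> U U0 openU; have [psi [Upsi [a _ psiE]]] := tau_dense U U0 openU.
  exists psi; split=> //; rewrite -psiE.
  exact/universal_abundant/universal_conj.
apply: (abundant_conj X_nat E_surj eK) => m n.
  exact: universal_abundant.
by have [k ck] := c_surj (m, n); have := phiP k Logic.I; rewrite ck.
Qed.

Lemma generic_LERF (tau : permRep G X) :
  (forall x, finite_set (rep_orbit tau x)) -> comeager (conj_orbit tau) -> LERF G.
Proof.
move=> tau_fin /comeager_dense tau_dense H [B /finite_seqP[S ->] HS].
exists [set K | subgroup_fi K /\ carrier H `<=` carrier K] => [K []//|].
apply/seteqP; split=> [g Hg K [_ HK]|g gK]; first exact: HK.
apply: contrapT => nHg.
have [T TE] : exists T : subgroup G, carrier T = setT by exact: subgroup_exists.
(* One copy of [G / H] plus infinitely many fixed points, the cosets of [T], fill [X] even when [H]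
   has finite index. *)
have [|phi [pt [ptM pt_inj pt_eq _]]] := @coset_rep G X G_fg X_nat nat
  (fun n => if n is 0 then H else T) (countableP _); first exact: infinite_nat.
pose x := pt 0%N 1.
have xH h : phi h x = x <-> carrier H h.
  rewrite ptM mulg1; split=> [/esym/pt_inj[_]|Hh]; first by rewrite invg1 mul1g.
  by apply/esym/pt_eq; rewrite invg1 mul1g.
pose l := (g, x) :: [seq (s, x) | s <- S].
have [|psi [agree [a _ psiE]]] :=
    tau_dense (rep_agree phi l) _ (@open_rep_agree _ _ phi l).
  by exists phi.
rewrite -{psi}psiE in agree.
have [K KE] := stabilizer_subgroup (conj_rep a tau) x.
have fiK : subgroup_fi K.
  exact: stabilizer_fi (conj_rep_orbit_finite (tau_fin _)) KE.
have HK : carrier H `<=` carrier K.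
  rewrite [carrier H]HS; apply: generated_sub_carrier => s sS; rewrite KE /=.
  rewrite (agree (s, x)) /=; last by rewrite inE map_f ?orbT.
  by apply/xH; rewrite HS; exact: generated_sub.
have := gK K (conj fiK HK); rewrite KE /= (agree (g, x)) ?mem_head //=.
by move=> /xH.
Qed.

Lemma LERF_dense_fi : LERF G -> dense (@subgroup_fi G).
Proof.
move=> lerf U U0 openU; have [H UH] : exists H : subgroup G, U H := U0.
have [F FU] := nbhs_subgroup_agree (open_nbhs_nbhs (conj openU UH)).
(* [L] is finitely generated and has the same trace on [F] as [H], so LERF applies to it. *)
have [L LE] := generated_subgroup ([set` F] `&` carrier H).
have [|K [fiK LK KL]] := @LERF_separates _ L F lerf.
  by exists ([set` F] `&` carrier H) => //; apply: finite_setIl; exact: finite_seq.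
exists K; split=> //; apply: FU => g gF; split=> [/(KL _ gF)|Hg].
  by rewrite LE; apply: generated_sub_carrier => ? [].
by apply: LK; rewrite LE; apply: generated_sub.
Qed.

End GenericRepresentation.

Theorem theorem1p5 (G : groupType) (X : choiceType)
    (G_fg : finitely_generated [set: G])
    (X_countably_infinite : [set: X] #= [set: nat]) :
  [<-> LERF G;
       dense (@subgroup_fi G);
       exists tau : permRep G X,
         (forall x : X, finite_set (rep_orbit tau x)) /\
         comeager (conj_orbit tau)].
Proof.
split; first exact: LERF_dense_fi.
split; first exact: dense_fi_generic.
move=> [tau [tau_fin tau_comeager]].
exact: generic_LERF G_fg X_countably_infinite tau tau_fin tau_comeager.
Qed.
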